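(* Let $F$ be a probability distribution on $(0,\infty)$ with positive Lebesgue density $f$ on $(0,\infty)$ and hazard rate $h=f/\overline F$. If $f$ has bounded increase with $\delta_f>1$, then $F\in\mathcal{E}$, and for every $\delta\in(1,\delta_f)$ there are positive constants $x_0=x_0(\delta)$ and $C(\delta)$ for which the Potter-type inequality $$\frac{f(y)}{f(x)}\le C(\delta)\left(\frac{y}{x}\right)^{-\delta},\qquad y\ge x\ge x_0,$$ holds and such that, for all $x\ge x_0$, $$x\,h(x)\ge\frac{\delta-1}{C(\delta)}.$$
   Context: $\overline F=1-F$ is the right tail of $F$. $F\in\mathcal{E}$ (extended rapidly varying tail) means that $\limsup_{x\to\infty}\overline F(ux)/\overline F(x)<1$ for some $u>1$. For a positive function $g$ on $(0,\infty)$, the (sign-normalized) lower Matuszewska index $\delta_g\in[-\infty,\infty]$ is the supremum of those $\delta\in\mathbb{R}$ for which there is a constant $C>0$ such that for every $U>1$, as $x\to\infty$, $g(ux)/g(x)\le C(1+o(1))u^{-\delta}$ uniformly in $u\in[1,U]$ (with $\sup\emptyset=-\infty$). The density $f$ has bounded increase if $\delta_f>-\infty$. *)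

(* Defs.v *)
From HB Require Import structures.
From mathcomp Require Import all_boot all_order all_algebra.
From mathcomp Require Import all_classical all_reals all_analysis.
Import Order.TTheory GRing.Theory Num.Theory.
Import numFieldNormedType.Exports.

Set Implicit Arguments.
Unset Strict Implicit.
Unset Printing Implicit Defensive.

Local Open Scope classical_set_scope.
Local Open Scope ring_scope.

Definition dist_fun (R : realType) (P : probability (measurableTypeR R) R)
  (x : R) : R := fine (P [set` `]-oo, x]]).

Definition tail (R : realType) (F : R -> R) (x : R) : R := 1 - F x.

Definition hazard_rate (R : realType) (F f : R -> R) (x : R) : R :=
  f x / tail F x.

(* Densities here live on the open half-line: the values of [f] outside
   ]0, +oo[ are never used. *)
Definition positive_density (R : realType)
    (P : probability (measurableTypeR R) R) (f : R -> R) : Prop :=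
  [/\ forall x, 0 < x -> 0 < f x,
      measurable_fun ([set` `]0, +oo[] : set (measurableTypeR R)) f &
      forall A : set (measurableTypeR R), measurable A ->
        P A = (\int[lebesgue_measure]_(x in A `&` [set` `]0%R, +oo[]) (f x)%:E)%E].

Definition extended_rapidly_varying (R : realType) (F : R -> R) : Prop :=
  exists2 u : R, 1 < u &
    (limf_esup (fun x : R => (tail F (u * x) / tail F x)%:E) +oo%R < 1)%E.

(* The o(1) term is [eta]; uniformity in u means that [eta] depends on x only
   (and on U), and that the range of x does not depend on u. *)
Definition matuszewska_bound (R : realType) (g : R -> R) (delta : R) : Prop :=
  exists2 C : R, 0 < C & forall U : R, 1 < U ->
    exists2 eta : R -> R, eta x @[x --> +oo] --> (0 : R) &
      \forall x \near +oo, forall u : R, 1 <= u <= U ->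
        g (u * x) / g x <= C * (1 + eta x) * u `^ (- delta).

Definition lower_matuszewska (R : realType) (g : R -> R) : \bar R :=
  ereal_sup [set delta%:E | delta in matuszewska_bound g].

Definition bounded_increase (R : realType) (g : R -> R) : Prop :=
  (-oo < lower_matuszewska g)%E.

(* Main.v *)
(* Choosing d < d' < delta_f, the Matuszewska bound at d' holds with some constant
   on one dilation range [1, U]; for U large the gain U^(d - d') absorbs that
   constant, so the bound at exponent d can be iterated over the powers of U,
   which is Potter's inequality.  Integrating it in y over ]x, +oo[ gives
   Fbar x <= C / (d - 1) * x f(x), the bound on the hazard rate.  Conversely a
   lower bound c on x h(x) forces a proportion of the tail to lie in ]x, 2x]:
   Fbar x - Fbar (2 x) >= (c / 2) Fbar (2 x), so Fbar (2 x) / Fbar x stays below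
   1 / (1 + c / 2) < 1. *)
Require Import Defs.
From HB Require Import structures.
From mathcomp Require Import all_boot all_order all_algebra.
From mathcomp Require Import all_classical all_reals all_analysis.
From mathcomp Require Import measurable_realfun.
From mathcomp Require Import ring lra.
Import Order.TTheory GRing.Theory Num.Theory.
Import numFieldNormedType.Exports.

Local Open Scope classical_set_scope.
Local Open Scope ring_scope.

(** * Power functions at infinity and their integrals *)

Lemma cvgr_powRy (R : realType) (p : R) : 0 < p -> x `^ p @[x --> +oo] --> +oo.
Proof.
move=> p0; apply/cvgryPge => A; near=> x.
have x0 : 0 <= x by near: x; exact: nbhs_pinfty_ge.
have [A0|A0] := leP A 0; first by rewrite (le_trans A0) ?powR_ge0.
have <- : (A `^ p^-1) `^ p = A.
  by rewrite -powRrM mulVf ?gt_eqF// powRr1// ltW.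
apply: ge0_ler_powR; rewrite ?nnegrE ?powR_ge0 ?(ltW p0)//.
Unshelve. all: by end_near. Qed.

Lemma cvgr_powRNy (R : realType) (p : R) :
  0 < p -> x `^ (- p) @[x --> +oo] --> 0.
Proof.
move=> p0.
under eq_fun do rewrite powRN.
apply: (gtr0_cvgV0 _).2; last exact: cvgr_powRy.
near=> x; rewrite powR_gt0//; near: x; exact: nbhs_pinfty_gt.
Unshelve. all: by end_near. Qed.

Lemma is_derive_neg_powR (R : realType) (d x : R) : 1 < d -> 0 < x ->
  is_derive x 1 (fun y : R => - (d - 1)^-1 * y `^ (1 - d)) (x `^ (- d)).
Proof.
move=> d1 x0.
have H := is_derive1_powR (1 - d) x0.
apply: is_derive_eq.
rewrite /GRing.scale/= mulrA.
have -> : - (d - 1)^-1 * (1 - d) = 1 by field; lra.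
rewrite mul1r; congr powR; ring.
Qed.

Lemma integral_powRN_itvcy (R : realType) (d x : R) : 1 < d -> 0 < x ->
  (\int[lebesgue_measure]_(y in `[x, +oo[) (y `^ (- d))%:E =
   (x `^ (1 - d) / (d - 1))%:E)%E.
Proof.
move=> d1 x0.
pose F (y : R) := - (d - 1)^-1 * y `^ (1 - d).
have dF (y : R) : 0 < y -> is_derive y 1 F (y `^ (- d)).
  exact: is_derive_neg_powR.
have cF (y : R) : 0 < y -> {for y, continuous F}.
  move=> y0; apply: differentiable_continuous; apply/derivable1_diffP.
  by have [] := dF _ y0.
have cf (y : R) : 0 < y -> {for y, continuous (fun z : R => z `^ (- d))}.
  move=> y0; apply: differentiable_continuous; apply/derivable1_diffP.
  by apply: derivable_powR; rewrite in_itv/= y0.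
(* Here [0] is the limit of the antiderivative [F] at infinity, the exponent [1 - d] being
   negative. *)
rewrite (@ge0_continuous_FTC2y _ _ F x 0).
- by rewrite sub0e -EFinN /F mulNr opprK mulrC.
- by move=> y _; exact: powR_ge0.
- apply/continuous_within_itvcyP; split.
    by move=> y; rewrite in_itv/= andbT => /(lt_trans x0); exact: cf.
  by apply: cvg_at_right_filter; exact: cf.
- rewrite -(mulr0 (- (d - 1)^-1)); apply: cvgMr.
  by rewrite -opprB; apply: cvgr_powRNy; rewrite subr_gt0.
- by move=> y xy; have [] := dF _ (lt_trans x0 xy).
- by apply: cvg_at_right_filter; exact: cF.
- move=> y; rewrite in_itv/= andbT => /(lt_trans x0) y0.
  by rewrite derive1E; have [_ ->] := dF _ y0.
Qed.

(** * Bounds near infinity and Potter's inequality *)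

(** The upper limit is an infimum of suprema over the sets of the filter, so a bound on a single
    such set suffices. *)
Lemma limf_esup_le (T : choiceType) (X : filteredType T) (R : realType)
    (g : X -> \bar R) (F : set (set X)) (V : set X) (k : \bar R) :
  F V -> (forall x, V x -> (g x <= k)%E) -> (limf_esup g F <= k)%E.
Proof.
move=> FV gk; rewrite limf_esupE.
apply: (@le_trans _ _ (ereal_sup (g @` V))).
  by apply: ereal_inf_lbound; exists V.
by apply: ge_ereal_sup => _ [x Vx <-]; exact: gk.
Qed.

Lemma near_pinfty_ge_ex (R : realType) (Q : R -> Prop) :
  (\forall x \near +oo, Q x) ->
  exists2 x0 : R, 0 < x0 & forall x, x0 <= x -> Q x.
Proof.
(* The filter only covers [M < x]; adding 1 allows the non-strict [x0 <= x] and makes [x0]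
   positive. *)
move=> [M [_ MQ]]; exists (Num.max M 0 + 1).
  by rewrite ltr_wpDl// le_max lexx orbT.
move=> x Mx; apply: MQ; apply: lt_le_trans Mx.
by rewrite ltr_pwDr// le_max lexx.
Qed.

Lemma potter_bound (R : realType) (f : R -> R) (d d' : R) :
  (forall x, 0 < x -> 0 < f x) -> matuszewska_bound f d' -> d < d' ->
  exists x0 C : R, [/\ 0 < x0, 0 < C &
    forall x y, x0 <= x -> x <= y -> f y / f x <= C * (y / x) `^ (- d)].
Proof.
move=> f0 [C C0 fC] dd'.
have d'd0 : 0 < d' - d by rewrite subr_gt0.
(* The factor 2 makes room for [1 + eta x], which is at most 2 for large [x]. *)
have [U0 U00 HU0] :=
  near_pinfty_ge_ex _ _ ((cvgryPge _).1 (cvgr_powRy _ _ d'd0) (C * 2)).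
(* The floor 2 gives [1 < U] and makes powers of [U] dominate powers of 2, which bounds the number
   of iterations. *)
pose U := Num.max U0 2.
have U1 : 1 < U by rewrite lt_max ltr1n orbT.
have Upos : 0 < U by exact: lt_trans U1.
have CU : C * 2 <= U `^ (d' - d) by apply: HU0; rewrite le_max lexx.
have [eta eta0 feta] := fC _ U1.
have [x0 x00 Hx0] : exists2 x0, 0 < x0 & forall x, x0 <= x ->
    forall u : R, 1 <= u <= U -> f (u * x) / f x <= C * 2 * u `^ (- d').
  apply: near_pinfty_ge_ex; near=> x => u u1U.
  have : eta x <= 1 by near: x; exact: (cvgr_le _ eta0 _ ltr01).
  move=> etax; apply: (@le_trans _ _ (C * (1 + eta x) * u `^ (- d'))).
    by move: u u1U; near: x; exact: feta.
  by rewrite ler_wpM2r ?powR_ge0// ler_pM2l//; lra.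
exists x0, (C * 2); split => //; first by rewrite mulr_gt0.
have local x u : x0 <= x -> 1 <= u <= U ->
    f (u * x) / f x <= C * 2 * u `^ (- d).
  move=> xx0 /[dup] /andP[u1 _] uU; apply: (le_trans (Hx0 _ xx0 _ uU)).
  by rewrite ler_pM2l ?mulr_gt0// ler_powR// lerN2 ltW.
(* At the full dilation [U] the constant [C * 2] is absorbed, so iterating accumulates no
   constants. *)
have step x : x0 <= x -> f (U * x) / f x <= U `^ (- d).
  move=> xx0; apply: (le_trans (Hx0 _ xx0 U _)); first by rewrite lexx ltW.
  rewrite (_ : - d = (d' - d) + (- d')); last by ring.
  rewrite powRD; last by apply/implyP => _; rewrite gt_eqF.
  by rewrite ler_wpM2r ?powR_ge0.
(* Induction on the number of dilations: [step] moves [x] to [U * x] until [y] lies in the current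
   range, where [local] costs [C * 2] once. With [n.+1] the base case is one full range. *)
suff main n x y : x0 <= x -> x <= y <= U ^+ n.+1 * x ->
    f y / f x <= C * 2 * (y / x) `^ (- d).
  move=> x y xx0 xy.
  have xp : 0 < x by exact: lt_le_trans xx0.
  pose n := Num.bound (y / x).
  apply: (main n) => //; rewrite xy/= -ler_pdivrMr//.
  apply: (@le_trans _ _ (2 ^+ n.+1)).
    exact/ltW/upper_nthrootP.
  by rewrite lerXn2r ?nnegrE ?(ltW Upos)// le_max lexx orbT.
elim: n x => [|n IH] x xx0 /andP[xy yU].
  have xp : 0 < x by exact: lt_le_trans xx0.
  rewrite -{1}(divfK (negbT (gt_eqF xp)) y); apply: local => //.
  by rewrite ler_pdivlMr// mul1r xy ler_pdivrMr.
have xp : 0 < x by exact: lt_le_trans xx0.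
have [yUx|Uxy] := leP y (U * x).
  rewrite -{1}(divfK (negbT (gt_eqF xp)) y); apply: local => //.
  by rewrite ler_pdivlMr// mul1r xy ler_pdivrMr.
have Ux0 : x0 <= U * x by rewrite (le_trans xx0)// ler_peMl ?ltW.
have Uxp : 0 < U * x by rewrite mulr_gt0.
have := IH (U * x) Ux0; rewrite (ltW Uxy)/= mulrA -exprSr yU => /(_ isT) IHy.
have -> : f y / f x = (f y / f (U * x)) * (f (U * x) / f x).
  by field; rewrite !gt_eqF ?f0.
have -> : (y / x) `^ (- d) = (y / (U * x)) `^ (- d) * U `^ (- d).
  rewrite -powRM ?(ltW Upos)//; last first.
    by rewrite divr_ge0 ?(ltW Uxp)// (le_trans (ltW xp)).
  by congr powR; field; rewrite !gt_eqF.
have yp : 0 < y by exact: lt_le_trans xy.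
by rewrite [leRHS]mulrA; apply: ler_pM => //;
  rewrite ?step// divr_ge0// ltW ?f0.
Unshelve. all: by end_near. Qed.

(** * Tails of a distribution with positive density *)

Section density.
Context {R : realType} {P : probability (measurableTypeR R) R} {f : R -> R}
  (f_density : positive_density P f).
Implicit Types x y : R.

Local Notation Fbar := (tail (dist_fun P)).
Local Notation mu := (@lebesgue_measure R).

Lemma density_gt0 x : 0 < x -> 0 < f x.
Proof. by case: f_density => + _ _; exact. Qed.

Lemma measurable_density (A : set (measurableTypeR R)) :
  A `<=` [set` `]0, +oo[] -> measurable A ->
  measurable_fun A (EFin \o f).
Proof.
move=> A0 mA; apply/measurable_EFinP; case: f_density => _ mf _.
by apply: measurable_funS mf => //; exact: measurable_itv.
Qed.

Lemma density_prob (A : set (measurableTypeR R)) :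
  A `<=` [set` `]0, +oo[] -> measurable A ->
  P A = (\int[mu]_(y in A) (f y)%:E)%E.
Proof. by case: f_density => _ _ Pf A0 mA; rewrite Pf// setIidl. Qed.

Lemma itvoy_sub x : 0 <= x -> [set` `]x, +oo[] `<=` [set` `]0, +oo[].
Proof.
by move=> x0 y /=; rewrite !in_itv/= !andbT; exact: le_lt_trans.
Qed.

Lemma tailE x : (Fbar x)%:E = P [set` `]x, +oo[].
Proof.
rewrite /tail /dist_fun EFinB fineK ?fin_num_measure//.
rewrite -probability_setC//.
by rewrite setCitvl.
Qed.

Lemma tail_integral x : 0 <= x ->
  (Fbar x)%:E = (\int[mu]_(y in `]x, +oo[) (f y)%:E)%E.
Proof.
by move=> x0; rewrite tailE density_prob//; exact: itvoy_sub.
Qed.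

(** Were the tail zero, [f] would vanish almost everywhere on the half-line beyond [x]; since [f] is
    positive there, that half-line would be null, against its infinite Lebesgue measure. *)
Lemma tail_gt0 x : 0 <= x -> 0 < Fbar x.
Proof.
move=> x0; rewrite lt_neqAle -lee_fin tailE measure_ge0 andbT.
apply/eqP => Fx0; have := tail_integral _ x0; rewrite -Fx0 => /esym.
have f0 y : `]x, +oo[%classic y -> 0 < f y.
  by rewrite /= in_itv/= andbT => xy; apply/density_gt0/(le_lt_trans x0).
have mf : measurable_fun (`]x, +oo[ : set (measurableTypeR R))
    (EFin \o f).
  by apply: measurable_density; [exact: itvoy_sub|exact: measurable_itv].
have -> : (\int[mu]_(y in `]x, +oo[) (f y)%:E =
    \int[mu]_(y in `]x, +oo[) `|(EFin \o f) y|)%E.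
  apply: eq_integral => y /set_mem/f0/ltW fy; by rewrite gee0_abs.
move=> /(ae_eq_integral_abs mu (measurable_itv _) mf).1 [N [mN N0 subN]].
have : (mu `]x, +oo[%classic <= mu N)%E.
  apply: le_measure; rewrite ?inE//.
  move=> y xy; apply: subN => /= /(_ xy) [] fy0.
  by have := f0 _ xy; rewrite fy0 ltxx.
by rewrite N0 lebesgue_measure_itv/= ltry.
Qed.

Lemma tail_le x y : x <= y -> Fbar y <= Fbar x.
Proof.
move=> xy; rewrite -lee_fin !tailE le_measure ?inE//.
by move=> z /=; rewrite !in_itv/= !andbT; exact: le_lt_trans.
Qed.

Lemma potter_tail (x0 C d : R) : 0 < x0 -> 0 < C -> 1 < d ->
  (forall x y, x0 <= x -> x <= y -> f y / f x <= C * (y / x) `^ (- d)) ->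
  forall x, x0 <= x -> Fbar x <= C / (d - 1) * (x * f x).
Proof.
move=> x00 C0 d1 potter x xx0.
have xp : 0 < x by exact: lt_le_trans xx0.
have fx := density_gt0 _ xp.
rewrite -lee_fin tail_integral ?(ltW xp)//.
(* [k] collects the factors of the Potter bound on [f y] that do not depend on [y]; what remains is
   the power of [y] with exponent [- d]. *)
pose k := C * f x * x `^ d.
have k0 : 0 <= k by rewrite !mulr_ge0 ?powR_ge0// ltW.
apply: (@le_trans _ _ (\int[mu]_(y in `]x, +oo[) (k%:E * (y `^ (- d))%:E))%E).
  apply: ge0_le_integral; first exact: measurable_itv.
  - move=> y /=; rewrite in_itv/= andbT => xy.
    by rewrite lee_fin ltW// density_gt0// (lt_trans xp).
  - by apply: measurable_density; [exact/itvoy_sub/ltW|exact: measurable_itv].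
  - apply/measurable_EFinP; apply: measurable_funTS.
    by apply: measurable_funM => //; exact: measurable_powR.
  - move=> y /=; rewrite in_itv/= andbT => xy.
    have := potter _ _ xx0 (ltW xy).
    rewrite -EFinM lee_fin ler_pdivrMr// => /le_trans; apply.
    rewrite powRM ?invr_ge0 ?(ltW xp) ?(ltW (lt_trans xp xy))//.
    rewrite -(powR_inv1 (ltW xp)) -powRrM.
    have -> : C * (y `^ (- d) * x `^ (-1 * - d)) * f x = k * y `^ (- d).
      by rewrite mulN1r opprK /k; ring.
    exact: lexx.
rewrite ge0_integralZl//=; first last.
- by move=> y _; rewrite lee_fin powR_ge0.
- by apply/measurable_EFinP; apply: measurable_funTS; exact: measurable_powR.
rewrite integral_itv_obnd_cbnd; last first.
  by apply/measurable_EFinP; apply: measurable_funTS; exact: measurable_powR.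
rewrite integral_powRN_itvcy// -EFinM lee_fin /k.
have xd : x `^ d * x `^ (1 - d) = x.
  rewrite -powRD; last by apply/implyP => _; rewrite gt_eqF.
  by rewrite addrC subrK powRr1// ltW.
have -> : C * f x * x `^ d * (x `^ (1 - d) / (d - 1)) =
    C / (d - 1) * (x `^ d * x `^ (1 - d) * f x) by ring.
by rewrite xd.
Qed.

(* On ]x, 2x] the hypothesis gives [f y >= c * Fbar y / y], and this is at least
   [c * Fbar (2 * x) / (2 * x)]. *)
Lemma tail_double (x0 c : R) : 0 < x0 -> 0 < c ->
  (forall x, x0 <= x -> c * Fbar x <= x * f x) ->
  forall x, x0 <= x -> Fbar (2 * x) * (1 + c / 2) <= Fbar x.
Proof.
move=> x00 c0 haz x xx0.
have xp : 0 < x by exact: lt_le_trans xx0.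
have x2x : x <= 2 * x by lra.
have sub0 : [set` `]x, 2 * x]] `<=` [set` `]0, +oo[].
  by move=> y /=; rewrite !in_itv/= andbT => /andP[+ _]; exact: lt_trans.
have mI : measurable ([set` `]x, 2 * x]] : set (measurableTypeR R)).
  exact: measurable_itv.
have -> : Fbar x = Fbar (2 * x) + fine (P [set` `]x, 2 * x]]).
  apply: EFin_inj; rewrite [RHS]EFinD !tailE fineK ?fin_num_measure//.
  rewrite -measureU//; last first.
    apply/seteqP; split => // y []/=; rewrite !in_itv/= andbT => xy /andP[_].
      by rewrite leNgt xy.
  congr (P _); apply/seteqP; split => y /=; rewrite !in_itv/= !andbT.
    by move=> ->; case: (ltP (2 * x) y) => _; [left|right].
  by case=> [/(le_lt_trans x2x)//|/andP[]].
rewrite mulrDr mulr1 lerD2l -lee_fin fineK ?fin_num_measure// density_prob//.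
(* The interval has length [x], which cancels the [x] in the constant integrand and leaves the
   factor [c / 2]. *)
have -> : (Fbar (2 * x) * (c / 2))%:E =
    (\int[mu]_(y in `]x, (2 * x)%R]) (cst (c * Fbar (2 * x) / (2 * x))%:E y))%E.
  rewrite integral_cst//=.
  rewrite lebesgue_measure_itv/= lte_fin ltr_pMl// ltr1n -EFinB -EFinM.
  by congr EFin; field; rewrite gt_eqF.
apply: ge0_le_integral => //.
- move=> y _; rewrite lee_fin; apply/ltW/divr_gt0; last by rewrite mulr_gt0.
  by rewrite mulr_gt0// tail_gt0// mulr_ge0// ltW.
- exact: measurable_density.
- move=> y /=; rewrite in_itv/= => /andP[xy yx].
  have yp : 0 < y by exact: lt_trans xy.
  rewrite lee_fin ler_pdivrMr ?mulr_gt0//.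
  apply: (@le_trans _ _ (c * Fbar y)); first by rewrite ler_pM2l// tail_le.
  apply: (le_trans (haz _ _)); first by rewrite (le_trans xx0)// ltW.
  by rewrite mulrC ler_pM2l// density_gt0.
Qed.

End density.

(** * Consequences of the index for the tail and the hazard rate *)

(** Below the supremum there is always an admissible exponent [d'] strictly above [d], the slack
    that [potter_bound] consumes. *)
Lemma lower_matuszewska_potter (R : realType) (f : R -> R) (d : R) :
  (forall x, 0 < x -> 0 < f x) -> (d%:E < lower_matuszewska f)%E ->
  exists x0 C : R, [/\ 0 < x0, 0 < C &
    forall x y, x0 <= x -> x <= y -> f y / f x <= C * (y / x) `^ (- d)].
Proof.
move=> f0 /ereal_sup_gt[_ [d' fd' <-]]; rewrite lte_fin.
exact: potter_bound.
Qed.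

Theorem proposition2p2 (R : realType)
    (P : probability (measurableTypeR R) R) (f : R -> R)
    (P_supp : P [set` `]0%R, +oo[] = 1%E)
    (f_density : positive_density P f)
    (f_bi : bounded_increase f)
    (f_index : (1 < lower_matuszewska f)%E) :
  extended_rapidly_varying (dist_fun P) /\
  forall delta : R, 1 < delta -> (delta%:E < lower_matuszewska f)%E ->
    exists x0 C : R,
      [/\ 0 < x0, 0 < C,
          forall x y : R, x0 <= x -> x <= y ->
            f y / f x <= C * (y / x) `^ (- delta) &
          forall x : R, x0 <= x ->
            (delta - 1) / C <= x * hazard_rate (dist_fun P) f x].
Proof.
have f0 := @density_gt0 _ _ _ f_density.
split.
  have [_ [d fd <-]] := ereal_sup_gt f_index; rewrite lte_fin => d1.
  (* The midpoint stays above 1, so the Potter bound is integrable, and below [d], so [potter_bound]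
     applies. *)
  pose e := (1 + d) / 2.
  have [e1 ed] : 1 < e /\ e < d by rewrite /e; split; lra.
  have [x0 [C [x00 C0 potter]]] := potter_bound _ _ _ _ f0 fd ed.
  have e10 : 0 < e - 1 by rewrite subr_gt0.
  have haz := potter_tail f_density _ _ _ x00 C0 e1 potter.
  (* [c] inverts the constant in [haz], so that [c] times the tail is at most [x * f x]. *)
  pose c := (e - 1) / C.
  have c0 : 0 < c by rewrite divr_gt0.
  have dbl : forall x, x0 <= x ->
      tail (dist_fun P) (2 * x) * (1 + c / 2) <= tail (dist_fun P) x.
    apply: (tail_double f_density _ _ x00 c0) => x /haz.
    by rewrite -ler_pdivlMl ?divr_gt0// invf_div.
  exists 2; first by rewrite ltr1n.
  apply: (@le_lt_trans _ _ ((1 + c / 2)^-1)%:E); last first.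
    by rewrite lte_fin invf_lt1; lra.
  apply: (limf_esup_le _ _ _ _ _ [set x | x0 <= x]).
    by apply: nbhs_pinfty_ge; rewrite num_real.
  move=> x /= xx0; have tx := tail_gt0 f_density x (ltW (lt_le_trans x00 xx0)).
  rewrite lee_fin ler_pdivrMr// ler_pdivlMl; last by lra.
  by rewrite mulrC dbl.
move=> d d1 fd.
have [x0 [C [x00 C0 potter]]] := lower_matuszewska_potter _ _ _ f0 fd.
(* The same [x0] and [C] serve both bounds: clearing the positive tail turns the hazard bound into
   [potter_tail]. *)
exists x0, C; split => // x xx0.
have tx := tail_gt0 f_density x (ltW (lt_le_trans x00 xx0)).
rewrite /hazard_rate mulrA ler_pdivlMr//.
rewrite -ler_pdivlMl ?divr_gt0 ?subr_gt0// invf_div.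
exact: (potter_tail f_density _ _ _ x00 C0 d1 potter).
Qed.
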